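(* $$\sum_{u\in\mathbb N^n} a^{|u|}\,\mathsf M_u(x)=\prod_{i=1}^n\frac{(at^{n-i})_\infty}{(ax_i)_\infty}.$$
   Context: Notation. Fix $n\ge 1$, a complex $q$ with $|q|<1$, and $t$, with $q,t$ generic (the coefficients of all polynomials below are rational functions of $q,t$). $\mathbb N=\{0,1,2,\dots\}$, $x=(x_1,\dots,x_n)$. A composition is $u=(u_1,\dots,u_n)\in\mathbb N^n$; $|u|=u_1+\cdots+u_n$. $(b)_\infty=\prod_{i\ge0}(1-bq^i)$. The spectral vector $\langle u\rangle\in\mathbb C^n$ has entries $\langle u\rangle_i=q^{u_i}t^{k_i}$, where $k_i=\#\{j:u_j<u_i\}+\#\{j>i:u_j=u_i\}$. The diagram of $u$ is the set of $s=(i,j)$ with $1\le i\le n$, $1\le j\le u_i$; for such $s$, $a(s)=u_i-j$ and $l(s)=\#\{k>i: j\le u_k\le u_i\}+\#\{k<i: j\le u_k+1\le u_i\}$. Put $n(u)=\sum_{s\in u}l(s)$, $n'(u)=\sum_i\binom{u_i}{2}$, $c'_u=\prod_{s\in u}(1-q^{a(s)+1}t^{l(s)})$. The interpolation Macdonald polynomial $M_u(x)$ is the unique polynomial of degree $|u|$ in $x_1,\dots,x_n$ such that $M_u(\langle v\rangle)=0$ for all $v\in\mathbb N^n$ with $|v|\le|u|$, $v\ne u$, and such that the coefficient of $x^u=x_1^{u_1}\cdots x_n^{u_n}$ is $q^{-n'(u)}$. Its normalised version is $\mathsf M_u(x)=q^{n'(u)}t^{n(u)}M_u(x)/c'_u$.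 The identity is understood as an identity of formal power series in $a$. *)

(* Defs.v *)
From mathcomp Require Import all_boot all_order all_algebra.
From mathcomp Require Import complex mpoly.
From mathcomp Require Import boolp classical_sets reals topology normedtype.
From mathcomp Require Import sequences.

Set Implicit Arguments.
Unset Strict Implicit.
Unset Printing Implicit Defensive.

Import Order.TTheory GRing.Theory Num.Theory.
Import numFieldNormedType.Exports.

Local Open Scope ring_scope.
Local Open Scope classical_set_scope.

(* A composition is a multinomial u : 'X_{1..n}, and |u| is mdeg u. Parts are
   indexed by 'I_n, hence from 0; columns of the diagram are indexed from 1. *)

Section Compositions.
Variables (n : nat) (u : 'X_{1..n}).

Definition spectral_exp (i : 'I_n) : nat :=
  (#|[pred j : 'I_n | u j < u i]|
   + #|[pred j : 'I_n | (i < j) && (u j == u i)]|)%N.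

Definition arm (i : 'I_n) (j : nat) : nat := (u i - j)%N.

Definition leg (i : 'I_n) (j : nat) : nat :=
  (#|[pred k : 'I_n | (i < k) && (j <= u k <= u i)]|
   + #|[pred k : 'I_n | (k < i) && (j <= (u k).+1 <= u i)]|)%N.

Definition nstat : nat :=
  (\sum_(i < n) \sum_(1 <= j < (u i).+1) leg i j)%N.

Definition nstat' : nat := (\sum_(i < n) 'C(u i, 2))%N.

End Compositions.

Section Interpolation.
Variables (K : fieldType) (n : nat) (q t : K).

Definition spectral (u : 'X_{1..n}) (i : 'I_n) : K :=
  q ^+ u i * t ^+ spectral_exp u i.

Definition hookprod (u : 'X_{1..n}) : K :=
  \prod_(i < n) \prod_(1 <= j < (u i).+1)
    (1 - q ^+ (arm u i j).+1 * t ^+ leg u i j).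

Definition is_interp_Macdonald (u : 'X_{1..n}) (p : {mpoly K[n]}) : Prop :=
  [/\ msize p = (mdeg u).+1,
      forall v : 'X_{1..n}, (mdeg v <= mdeg u)%N -> v <> u ->
        p.@[spectral v] = 0
    & p@_u = q ^- nstat' u].

(* "The" polynomial with the defining properties; xget falls back to 0 only
   if there is none. *)
Definition interp_Macdonald (u : 'X_{1..n}) : {mpoly K[n]} :=
  xget 0 (is_interp_Macdonald u).

Definition normed_interp_Macdonald (u : 'X_{1..n}) : {mpoly K[n]} :=
  (q ^+ nstat' u * t ^+ nstat u / hookprod u) *: interp_Macdonald u.

End Interpolation.

(* Formal power series in one indeterminate a, as coefficient sequences. *)
Definition fps (K : Type) := nat -> K.

Section FormalPowerSeries.
Variable K : fieldType.
Implicit Types f g : fps K.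

Definition fps_one : fps K := fun m => (m == 0%N)%:R.

Definition fps_mul f g : fps K :=
  fun m => \sum_(i < m.+1) f i * g (m - i)%N.

(* The first m coefficients of 1/f, for f 0 != 0 *)
Fixpoint fps_inv_seq f (m : nat) : seq K :=
  if m is m'.+1 then
    let s := fps_inv_seq f m' in
    rcons s (((m' == 0%N)%:R - \sum_(i < m') s`_i * f (m' - i)%N) / f 0%N)
  else [::].

Definition fps_inv f : fps K := fun m => (fps_inv_seq f m.+1)`_m.

Definition fps_div f g : fps K := fps_mul f (fps_inv g).

Lemma size_fps_inv_seq f m : size (fps_inv_seq f m) = m.
Proof. by elim: m => //= m IH; rewrite size_rcons IH. Qed.

Lemma nth_fps_inv_seq f m i : (i < m)%N -> (fps_inv_seq f m)`_i = fps_inv f i.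
Proof.
elim: m => // m IH; rewrite ltnS leq_eqVlt => /orP[/eqP -> //|lt_im].
by rewrite /= nth_rcons size_fps_inv_seq lt_im IH.
Qed.

Lemma fps_invP f : f 0%N != 0 -> fps_mul (fps_inv f) f = fps_one.
Proof.
move=> f0; apply/funext => m; rewrite /fps_mul /fps_one big_ord_recr /= subnn.
rewrite {2}/fps_inv /= nth_rcons size_fps_inv_seq ltnn eqxx divfK //.
under [X in _ - X]eq_bigr => i _ do rewrite nth_fps_inv_seq //.
by rewrite addrC subrK.
Qed.

(* The series \sum_u a^|u| F(u), u ranging over all compositions *)
Definition composition_series (n : nat) (F : 'X_{1..n} -> K) : fps K :=
  fun k => \sum_(u : 'X_{1..n < k.+1} | mdeg u == k) F u.

End FormalPowerSeries.

(* The expansion in powers of a of (a z)_oo = \prod_(i >= 0) (1 - a z q^i): the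
   coefficientwise limit of the partial products, 'X standing for a. The
   topology of R[i] is carried by its regular alias R[i]^o. *)
Definition qpoch_series (R : realType) (q z : R[i]) : fps R[i] :=
  fun m => lim (((\prod_(i < N) (1 - (z * q ^+ i) *: 'X) : {poly R[i]})`_m
                   : R[i]^o) @[N --> \oo]).

(* Main.v *)
Require Import Defs.
From HB Require Import structures.
From mathcomp Require Import all_boot all_order all_algebra.
From mathcomp Require Import complex mpoly.
From mathcomp Require Import boolp classical_sets reals topology normedtype.
From mathcomp Require Import sequences.
From mathcomp Require Import zify ring.

(* The coefficient of a^k on the right-hand side is a polynomial G_k in x of
   degree at most k, and a polynomial of degree at most k is determined by its
   values at the <v> with |v| <= k. At x = <v> the right-hand side telescopes to
   the product over i of (1 - a t^(k_i)) ... (1 - a t^(k_i) q^(v_i - 1)), which has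
   degree |v| in a; so G_k(<v>) vanishes for |v| < k, and for |v| = k it is the
   top coefficient of that product. It remains to see that the normalised M_v
   takes this same value at <v>, that is, to know the coefficient of x^v in the
   Lagrange polynomial of <v>. Every composition is built from the empty one by
   v |-> (v, 0) and Phi : v |-> (v_2, ..., v_n, v_1 + 1), for which
     <(v, 0)> = (t <v>, 1)  and  <Phi v> = (<v>_2, ..., <v>_n, q <v>_1);
   only <Phi v> has a last entry different from 1, so that interpolation proceeds
   by writing p = p0(x_1/t, ..., x_(n-1)/t) + (x_n - 1) r(x_n/q, x_1, ..., x_(n-1)),
   and the leading coefficient follows this recursion. *)

Set Implicit Arguments.
Unset Strict Implicit.
Unset Printing Implicit Defensive.

Import Order.TTheory GRing.Theory Num.Theory.
Import numFieldNormedType.Exports.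

Local Open Scope ring_scope.

(** * Compositions and their diagrams *)

Lemma card_sum_bool (T : finType) (P : pred T) :
  #|[pred j | P j]| = (\sum_j P j)%N.
Proof. by rewrite -sum1_card big_mkcond /=; apply: eq_bigr => j _; rewrite inE; case: (P j). Qed.

Lemma val_ordS n (i : 'I_n.+1) :
  ordS i = (if i == ord_max then 0 else i.+1)%N :> nat.
Proof.
rewrite /= -val_eqE /=; case: eqP => [->|ne]; first by rewrite modnn.
by rewrite modn_small //; have := ltn_ord i; lia.
Qed.

Lemma ordS_max n : ordS (ord_max : 'I_n.+1) = ord0.
Proof. by apply/ord_inj; rewrite val_ordS eqxx. Qed.

(* The affine generator Phi of Knop and Sahi. *)
Definition mnm_raise n (u : 'X_{1..n.+1}) : 'X_{1..n.+1} :=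
  [multinom (u (ordS i) + (i == ord_max))%N | i < n.+1].

Lemma mnm_raiseE n (u : 'X_{1..n.+1}) i :
  mnm_raise u i = (u (ordS i) + (i == ord_max))%N.
Proof. by rewrite mnmE. Qed.

Lemma mdeg_raise n (u : 'X_{1..n.+1}) : mdeg (mnm_raise u) = (mdeg u).+1.
Proof.
rewrite !mdegE; under eq_bigr do rewrite mnm_raiseE.
rewrite big_split /= [in RHS](reindex_inj (@ordS_inj _)) /= -[RHS]addn1; congr (_ + _)%N.
by rewrite -card_sum_bool -(card1 (ord_max : 'I_n.+1)); apply: eq_card.
Qed.

Lemma mdeg_mnmwiden n (u : 'X_{1..n}) : mdeg (mnmwiden u) = mdeg u.
Proof.
rewrite !mdegE big_ord_recr /= mnmwiden_ordmax addn0.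
by apply: eq_bigr => i _; rewrite mnmwiden_widen.
Qed.

Lemma mnm_widen_or_raise n (v : 'X_{1..n.+1}) :
  (exists u, v = mnmwiden u) \/ (exists u, v = mnm_raise u).
Proof.
have [v0|vN0] := eqVneq (v ord_max) 0%N; [left|right].
  exists [multinom v (widen_ord (leqnSn n) i) | i < n]; apply/mnmP => i.
  case: (unliftP ord_max i) => [j|] ->; last by rewrite mnmwiden_ordmax.
  have -> : lift ord_max j = widen_ord (leqnSn n) j.
    by apply/ord_inj; rewrite lift_max.
  by rewrite mnmwiden_widen mnmE.
exists [multinom (v (ord_pred i) - (i == ord0))%N | i < n.+1]; apply/mnmP => i.
rewrite mnm_raiseE mnmE ordSK -ordS_max (inj_eq (@ordS_inj _)).
by case: eqVneq => [->|_]; rewrite ?subn0 ?addn0 // subnK // lt0n.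
Qed.

(** Outer induction on the number of parts, inner induction on the degree, which [mnm_raise]
    increases by 1. *)
Lemma mnm_ind (P : forall n, 'X_{1..n} -> Prop) :
    P 0%N 0%MM ->
    (forall n u, P n u -> P n.+1 (mnmwiden u)) ->
    (forall n u, P n.+1 u -> P n.+1 (mnm_raise u)) ->
  forall n u, P n u.
Proof.
move=> P0 Pw Pr; elim=> [|n IHn] u.
  by have -> : u = 0%MM by apply/mnmP; case.
have [d] := ubnP (mdeg u); elim: d u => // d IHd u.
case: (mnm_widen_or_raise u) => -[v ->]; first by rewrite mdeg_mnmwiden => _; apply: Pw.
by rewrite mdeg_raise ltnS => /IHd/Pr.
Qed.

Lemma spectral_expE n (u : 'X_{1..n}) i :
  spectral_exp u i = (\sum_j ((u j < u i) || (i < j) && (u j == u i)))%N.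
Proof.
rewrite /spectral_exp !card_sum_bool -big_split /=; apply: eq_bigr => j _.
by case: (ltngtP (u j) (u i)); case: (i < j)%N.
Qed.

Lemma legE n (u : 'X_{1..n}) i j :
  leg u i j = (\sum_(k < n) ((i < k) && (j <= u k <= u i)
                          || (k < i) && (j <= (u k).+1 <= u i)))%N.
Proof.
rewrite /leg !card_sum_bool -big_split /=; apply: eq_bigr => k _.
by case: (ltngtP i k) => //=; rewrite ?orbF ?addn0.
Qed.

Lemma spectral_exp_lt n (u : 'X_{1..n}) i : (spectral_exp u i < n)%N.
Proof.
rewrite spectral_expE -card_sum_bool -[X in (_ < X)%N]card_ord.
apply: proper_card; apply/properP; split; first by apply/fintype.subsetP.
by exists i => //; rewrite !inE !ltnn.
Qed.

Lemma spectral_exp_inj n (u : 'X_{1..n}) : injective (spectral_exp u).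
Proof.
(* [spectral_exp u i] counts the predecessors of [i] in a strict total order: smaller parts first,
   and among equal parts the rightmost first. *)
suff lt i j : (u j < u i)%N || (i < j)%N && (u j == u i) ->
    (spectral_exp u j < spectral_exp u i)%N.
  move=> i j eq_ij; apply/eqP; apply: contraT => ne_ij.
  have {}ne_ij : (i != j :> nat) by [].
  have [lt_ji|lt_ij] : (u j < u i)%N || (i < j)%N && (u j == u i) \/
                       (u i < u j)%N || (j < i)%N && (u i == u j) by lia.
    by have := lt _ _ lt_ji; rewrite eq_ij ltnn.
  by have := lt _ _ lt_ij; rewrite eq_ij ltnn.
move=> lt_ji; rewrite !spectral_expE -!card_sum_bool.
apply: proper_card; apply/properP; split; last first.
  by exists j; rewrite !inE // !ltnn.
by apply/fintype.subsetP => k; rewrite !inE; move: lt_ji; lia.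
Qed.

Lemma spectral_exp_widen n (u : 'X_{1..n}) i :
  spectral_exp (mnmwiden u) (widen_ord (leqnSn n) i) = (spectral_exp u i).+1.
Proof.
rewrite !spectral_expE big_ord_recr /= mnmwiden_ordmax mnmwiden_widen ltn_ord /=.
rewrite (_ : (_ || _) = true) ?addn1; last by case: (u i).
congr _.+1.
by apply: eq_bigr => j _; rewrite mnmwiden_widen.
Qed.

Lemma spectral_exp_widen_max n (u : 'X_{1..n}) :
  spectral_exp (mnmwiden u) ord_max = 0%N.
Proof.
rewrite spectral_expE mnmwiden_ordmax big1 // => j _.
by rewrite ltn0 /=; have := ltn_ord j; case: ltnP => // ?; lia.
Qed.

Lemma raise_cases n (i : 'I_n.+1) :
  (i = ord_max /\ ordS i = ord0) \/
  [/\ (i < n)%N, (n < i)%N = false, (i == ord_max) = false & ordS i = i.+1 :> nat].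
Proof.
rewrite val_ordS; case: (eqVneq i ord_max) => [->|ne]; [left|right].
  by rewrite ordS_max.
by move: ne; rewrite -val_eqE /= => ne; split=> //; have := ltn_ord i; lia.
Qed.

(** The order of the parts behind [spectral_exp] survives: a part equal to u_1 preceded it by the
    tie rule and is now smaller; a part equal to u_1 + 1 came after it and still does, since the
    raised part is now the rightmost. *)
Lemma spectral_exp_raise n (u : 'X_{1..n.+1}) i :
  spectral_exp (mnm_raise u) i = spectral_exp u (ordS i).
Proof.
rewrite !spectral_expE [RHS](reindex_inj (@ordS_inj _)).
apply: eq_bigr => j _; rewrite !mnm_raiseE; congr (nat_of_bool _).
case: (raise_cases i) => [[-> ->]|[lt_i gt_i -> eq_i]];
 case: (raise_cases j) => [[-> ->]|[lt_j gt_j -> eq_j]]; rewrite ?eq_i ?eq_j ?eqxx /=; lia.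
Qed.

Lemma leg_widen n (u : 'X_{1..n}) i j : (0 < j)%N ->
  leg (mnmwiden u) (widen_ord (leqnSn n) i) j = leg u i j.
Proof.
move=> j0; rewrite !legE big_ord_recr /= mnmwiden_ordmax mnmwiden_widen.
have -> : (j <= 0)%N = false by case: j j0.
rewrite !andbF ltnNge leq_eqVlt ltn_ord orbT /= addn0.
by apply: eq_bigr => k _; rewrite mnmwiden_widen.
Qed.

(** The term u_k + 1 for k < i in the leg absorbs the passage of the first row to the end; only in
    the raised row do the columns shift by 1. *)
Lemma leg_raise n (u : 'X_{1..n.+1}) i j : (0 < j)%N ->
  leg (mnm_raise u) i (j + (i == ord_max)) = leg u (ordS i) j.
Proof.
move=> j0; rewrite !legE [RHS](reindex_inj (@ordS_inj _)).
apply: eq_bigr => k _; rewrite !mnm_raiseE; congr (nat_of_bool _).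
case: (raise_cases i) => [[-> ->]|[lt_i gt_i -> eq_i]];
 case: (raise_cases k) => [[-> ->]|[lt_k gt_k -> eq_k]]; 
 rewrite ?eq_i ?eq_k ?eqxx ?addn0 ?addn1 ?ltnS ?ltnn ?gt_i ?gt_k ?lt_i ?lt_k //= ?orbF //.
Qed.

(** In column 1 the lower bound on u_k + 1 is automatic. What remains is u_k <= u_1, which for the
    first row says that k precedes it in the order behind [spectral_exp]. *)
Lemma leg_raise_first n (u : 'X_{1..n.+1}) :
  leg (mnm_raise u) ord_max 1 = spectral_exp u ord0.
Proof.
rewrite legE spectral_expE [RHS](reindex_inj (@ordS_inj _)).
apply: eq_bigr => k _; rewrite !mnm_raiseE; congr (nat_of_bool _).
rewrite eqxx.
rewrite ordS_max addn1; case: (raise_cases k) => [[-> ->]|[lt_k gt_k -> eq_k]].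
  by rewrite !ltnn.
by rewrite eq_k gt_k lt_k addn0 /= ltnS leq_eqVlt orbC.
Qed.

(** * Sums and products over the cells of a diagram *)

Section DiagramStatistics.
Variables (T : Type) (idx : T) (op : Monoid.com_law idx) (F : nat -> nat -> T).

Definition diagram_big n (u : 'X_{1..n}) : T :=
  \big[op/idx]_(i < n) \big[op/idx]_(1 <= j < (u i).+1) F (arm u i j) (leg u i j).

Lemma diagram_big0 (u : 'X_{1..0}) : diagram_big u = idx.
Proof. by rewrite /diagram_big big_ord0. Qed.

Lemma diagram_big_widen n (u : 'X_{1..n}) :
  diagram_big (mnmwiden u) = diagram_big u.
Proof.
rewrite /diagram_big big_ord_recr /= mnmwiden_ordmax [X in op _ X]big_geq //.
rewrite Monoid.mulm1; apply: eq_bigr => i _; rewrite mnmwiden_widen.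
by apply: eq_big_nat => j /andP[j0 _]; rewrite leg_widen // /arm mnmwiden_widen.
Qed.

(** Raising creates one cell, column 1 of the last row, with arm u_1; every old cell moves along and
    keeps its arm and leg. *)
Lemma diagram_big_raise n (u : 'X_{1..n.+1}) :
  diagram_big (mnm_raise u) = op (F (u ord0) (spectral_exp u ord0)) (diagram_big u).
Proof.
rewrite /diagram_big [in RHS](reindex_inj (@ordS_inj _)) /=.
rewrite [LHS](bigD1 (ord_max : 'I_n.+1)) // [in RHS](bigD1 (ord_max : 'I_n.+1)) //=.
rewrite Monoid.mulmA; congr (op _ _).
  rewrite mnm_raiseE eqxx addn1 big_nat_recl //= ordS_max; congr (op _ _).
    by rewrite leg_raise_first /arm mnm_raiseE ordS_max eqxx addn1 subn1.
  apply: eq_big_nat => j /andP[j0 _].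
  have := leg_raise u ord_max j0; rewrite eqxx addn1 ordS_max => ->.
  by rewrite /arm mnm_raiseE eqxx ordS_max addn1 subSS.
apply: eq_bigr => i ne_i; rewrite mnm_raiseE (negPf ne_i) addn0.
apply: eq_big_nat => j /andP[j0 _].
have := leg_raise u i j0; rewrite (negPf ne_i) addn0 => ->.
by rewrite /arm mnm_raiseE (negPf ne_i) addn0.
Qed.

End DiagramStatistics.

(** * Polynomials in several variables *)

Section Msize.
Variables (K : fieldType) (n : nat).
Implicit Types p q : {mpoly K[n]}.

Lemma msize_leP p k :
  reflect (forall m, (k <= mdeg m)%N -> p@_m = 0) (msize p <= k)%N.
Proof.
apply: (iffP idP) => [le_pk m le_km|p0].
  by apply: memN_msupp_eq0; apply: msize_mdeg_ge; apply: leq_trans le_km.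
rewrite msizeE; apply/bigmax_leqP_seq => m m_p _; move: m_p; rewrite mcoeff_msupp.
by apply: contraR; rewrite -leqNgt => /p0 ->.
Qed.

Lemma msizeD_leq p q k :
  (msize p <= k -> msize q <= k -> msize (p + q) <= k)%N.
Proof.
move=> /msize_leP p0 /msize_leP q0; apply/msize_leP => m le_km.
by rewrite mcoeffD p0 // q0 // addr0.
Qed.

Lemma msize_sum_leq (I : Type) (r : seq I) (P : pred I) (F : I -> {mpoly K[n]}) k :
  (forall i, P i -> msize (F i) <= k)%N -> (msize (\sum_(i <- r | P i) F i) <= k)%N.
Proof.
move=> le_F; apply: (big_ind (fun p => msize p <= k)%N) => //.
- by rewrite msize0.
- by move=> p q; apply: msizeD_leq.
Qed.

Lemma msizeM_leq p q a b :
  (msize p <= a.+1 -> msize q <= b.+1 -> msize (p * q) <= (a + b).+1)%N.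
Proof.
have [->|p0] := eqVneq p 0; first by rewrite mul0r msize0.
have [->|q0] := eqVneq q 0; first by rewrite mulr0 msize0.
rewrite msizeM // => p_le q_le; rewrite -subn1 leq_subLR add1n -addSn -addnS.
exact: leq_add.
Qed.

Lemma meval_widthE p k (x : 'I_n -> K) : (msize p <= k)%N ->
  p.@[x] = \sum_(m : 'X_{1..n < k}) p@_m * \prod_i x i ^+ m i.
Proof.
move=> /mpolywE {1}->; rewrite raddf_sum /=; apply: eq_bigr => m _.
by rewrite mevalZ mevalX.
Qed.

End Msize.

(** * Substitutions that send monomials to multiples of monomials *)

Section MonomialMap.
Variables (K : fieldType) (n k : nat).
Variables (g : 'X_{1..n} -> 'X_{1..k}) (c : 'X_{1..n} -> K).
Hypothesis g_inj : injective g.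
Hypothesis mdeg_g : forall m, mdeg (g m) = mdeg m.
Implicit Type p : {mpoly K[n]}.

(** Models rescaling and renaming the variables. Working on monomials makes single coefficients and
    the degree readable. *)
Definition monomial_map p : {mpoly K[k]} :=
  \sum_(m <- msupp p) (c m * p@_m) *: 'X_[g m].

Lemma meval_monomial_map p x y :
  (forall m, c m * \prod_i x i ^+ g m i = \prod_i y i ^+ m i) ->
  (monomial_map p).@[x] = p.@[y].
Proof.
move=> cE; rewrite [p.@[y]]mevalE raddf_sum /=; apply: eq_bigr => m _.
by rewrite mevalZ mevalX -cE mulrCA mulrA.
Qed.

Lemma mcoeff_monomial_map p m : (monomial_map p)@_(g m) = c m * p@_m.
Proof.
rewrite raddf_sum /=; have [m_p|/memN_msupp_eq0 pm0] := boolP (m \in msupp p).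
  rewrite (bigD1_seq m) ?msupp_uniq //= mcoeffZ mcoeffX eqxx mulr1 big1 ?addr0 //.
  by move=> m' ne_m'; rewrite mcoeffZ mcoeffX (inj_eq g_inj) (negPf ne_m') mulr0.
rewrite pm0 mulr0 big1 // => m' _; rewrite mcoeffZ mcoeffX (inj_eq g_inj).
by case: eqP => [->|_]; rewrite ?pm0 !mulr0 ?mul0r.
Qed.

Lemma msize_monomial_map p : (msize (monomial_map p) <= msize p)%N.
Proof.
rewrite /monomial_map big_seq; apply: msize_sum_leq => m m_p.
by apply: leq_trans (msizeZ_le _ _) _; rewrite msizeX mdeg_g msize_mdeg_lt.
Qed.

End MonomialMap.

Definition mnm_rot n (u : 'X_{1..n.+1}) : 'X_{1..n.+1} :=
  [multinom u (ordS i) | i < n.+1].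

Lemma mdeg_rot n (u : 'X_{1..n.+1}) : mdeg (mnm_rot u) = mdeg u.
Proof.
rewrite !mdegE [RHS](reindex_inj (@ordS_inj _)).
by apply: eq_bigr => i _; rewrite mnmE.
Qed.

Lemma mnm_rot_inj n : injective (@mnm_rot n).
Proof.
move=> u v /mnmP eq_uv; apply/mnmP => i.
by have := eq_uv (ord_pred i); rewrite !mnmE ord_predK.
Qed.

Lemma mnm_raise_rot n (u : 'X_{1..n.+1}) :
  mnm_raise u = (U_(ord_max) + mnm_rot u)%MM.
Proof. by apply/mnmP => i; rewrite mnm_raiseE mnmDE mnm1E mnmE addnC eq_sym. Qed.

(** * Multiplication by x_n - 1 and top-degree coefficients *)

Section LastVariable.
Variables (K : fieldType) (n : nat).
Implicit Type r : {mpoly K[n.+1]}.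

Lemma msize_mulX_sub1 r d :
  (msize r <= d)%N -> (msize (('X_ord_max - 1) * r) <= d.+1)%N.
Proof.
case: d => [|d] r_le.
  by move: r_le; rewrite leqn0 msize_poly_eq0 => /eqP ->; rewrite mulr0 msize0.
rewrite -[d.+1]add1n; apply: msizeM_leq => //.
apply: msizeD_leq; first by rewrite msizeX mdeg1.
by rewrite -mpolyC1 -mpolyCN msizeC; case: eqP.
Qed.

(** The summand [- r] has no monomial of degree [d] or more, so only the product with the last
    variable is seen. *)
Lemma mcoeff_mulX_sub1 r m d : (msize r <= d)%N -> (d <= mdeg m)%N ->
  (('X_ord_max - 1) * r)@_m = (r * 'X_ord_max)@_m.
Proof.
move=> /msize_leP r0 /r0 rm0.
by rewrite mulrBl mul1r mcoeffB rm0 subr0 mulrC.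
Qed.

Lemma mcoeff_mulX_sub1_widen r (m : 'X_{1..n}) :
  (msize r <= mdeg m)%N -> (('X_ord_max - 1) * r)@_(mnmwiden m) = 0.
Proof.
move=> r_le; rewrite (mcoeff_mulX_sub1 r_le) ?mdeg_mnmwiden //.
apply: memN_msupp_eq0; rewrite (perm_mem (msuppMX _ _)).
apply/mapP => -[m' _ /mnmP/(_ ord_max)].
by rewrite mnmwiden_ordmax mnmDE mnm1E eqxx.
Qed.

Lemma mcoeff_mulX_sub1_raise r (m : 'X_{1..n.+1}) :
  (msize r <= (mdeg m).+1)%N ->
  (('X_ord_max - 1) * r)@_(mnm_raise m) = r@_(mnm_rot m).
Proof.
move=> r_le; rewrite (mcoeff_mulX_sub1 r_le) ?mdeg_raise //.
by rewrite mnm_raise_rot mcoeffMX.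
Qed.

End LastVariable.

(** * Interpolation at the spectral vectors *)

Section Interpolation.
Variables (K : fieldType) (q t : K).
Hypotheses (q_neq0 : q != 0) (t_neq0 : t != 0).
Hypothesis qt_generic : forall i j : nat, (0 < i)%N -> q ^+ i * t ^+ j != 1.
Local Notation sp := (spectral q t).

Lemma spectral_widen n (u : 'X_{1..n}) i :
  sp (mnmwiden u) (widen_ord (leqnSn n) i) = t * sp u i.
Proof. by rewrite /spectral mnmwiden_widen spectral_exp_widen exprS mulrCA. Qed.

Lemma spectral_widen_max n (u : 'X_{1..n}) : sp (mnmwiden u) ord_max = 1.
Proof. by rewrite /spectral mnmwiden_ordmax spectral_exp_widen_max mulr1. Qed.

Lemma spectral_raise n (u : 'X_{1..n.+1}) i :
  sp (mnm_raise u) i = q ^+ (i == ord_max) * sp u (ordS i).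
Proof. by rewrite /spectral mnm_raiseE spectral_exp_raise exprD mulrAC mulrC. Qed.

Lemma spectral_raise_max n (u : 'X_{1..n.+1}) :
  sp (mnm_raise u) ord_max = q * sp u ord0.
Proof. by rewrite spectral_raise eqxx ordS_max. Qed.

(** The last entry of <Phi u> is q^(u_1 + 1) t^k with k = k_1, so genericity applies: the factor x_n
    - 1 can be divided out at these nodes. *)
Lemma spectral_raise_max_sub1 n (u : 'X_{1..n.+1}) : sp (mnm_raise u) ord_max - 1 != 0.
Proof. by rewrite spectral_raise_max /spectral mulrA -exprS subr_eq0 qt_generic. Qed.

(** As a function this is p(x_1/t, ..., x_n/t), in n + 1 variables. *)
Definition mwiden_scale n (p : {mpoly K[n]}) : {mpoly K[n.+1]} :=
  monomial_map (@mnmwiden n) (fun m => t ^- mdeg m) p.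

(** As a function this is p(x_(n+1)/q, x_1, ..., x_n). *)
Definition mrot_scale n (p : {mpoly K[n.+1]}) : {mpoly K[n.+1]} :=
  monomial_map (@mnm_rot n) (fun m => q ^- m ord0) p.

Lemma mwiden_scale_spectral n (p : {mpoly K[n]}) u :
  (mwiden_scale p).@[sp (mnmwiden u)] = p.@[sp u].
Proof.
apply: meval_monomial_map => m.
rewrite big_ord_recr /= mnmwiden_ordmax mulr1.
under eq_bigr do rewrite mnmwiden_widen spectral_widen exprMn.
by rewrite big_split /= prodrXr -mdegE mulKf ?expf_neq0.
Qed.

Lemma mrot_scale_spectral n (p : {mpoly K[n.+1]}) u :
  (mrot_scale p).@[sp (mnm_raise u)] = p.@[sp u].
Proof.
apply: meval_monomial_map => m.
under eq_bigr do rewrite mnmE spectral_raise exprMn.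
rewrite big_split /= (bigD1 ord_max) //= ordS_max big1 ?mulr1 => [|i /negPf ->]; last first.
  by rewrite expr1n.
by rewrite eqxx expr1 mulKf ?expf_neq0 // [RHS](reindex_inj (@ordS_inj _)).
Qed.

Definition interp_step n (p : {mpoly K[n]}) (r : {mpoly K[n.+1]}) :=
  mwiden_scale p + ('X_ord_max - 1) * mrot_scale r.

Lemma msize_interp_step n (p : {mpoly K[n]}) (r : {mpoly K[n.+1]}) d :
  (msize p <= d.+1 -> msize r <= d -> msize (interp_step p r) <= d.+1)%N.
Proof.
move=> p_le r_le; apply: msizeD_leq.
  by apply: leq_trans p_le; apply: msize_monomial_map; exact: mdeg_mnmwiden.
by apply: msize_mulX_sub1; apply: leq_trans r_le; apply: msize_monomial_map; exact: mdeg_rot.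
Qed.

Lemma interp_step_widen n (p : {mpoly K[n]}) (r : {mpoly K[n.+1]}) u :
  (interp_step p r).@[sp (mnmwiden u)] = p.@[sp u].
Proof.
rewrite mevalD mevalM mevalB mevalXU meval1 spectral_widen_max subrr mul0r addr0.
exact: mwiden_scale_spectral.
Qed.

Lemma interp_step_raise n (p : {mpoly K[n]}) (r : {mpoly K[n.+1]}) u :
  (interp_step p r).@[sp (mnm_raise u)]
  = (mwiden_scale p).@[sp (mnm_raise u)] + (sp (mnm_raise u) ord_max - 1) * r.@[sp u].
Proof. by rewrite mevalD mevalM mevalB mevalXU meval1 mrot_scale_spectral. Qed.

Lemma mcoeff_interp_step_widen n (p : {mpoly K[n]}) (r : {mpoly K[n.+1]}) u :
  (msize r <= mdeg u)%N ->
  (interp_step p r)@_(mnmwiden u) = t ^- mdeg u * p@_u.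
Proof.
move=> r_le; rewrite mcoeffD mcoeff_mulX_sub1_widen ?addr0.
  by apply: mcoeff_monomial_map; exact: inj_mnmwiden.
by apply: leq_trans r_le; apply: msize_monomial_map; exact: mdeg_rot.
Qed.

Lemma mcoeff_interp_step0_raise n (r : {mpoly K[n.+1]}) u :
  (msize r <= (mdeg u).+1)%N ->
  (interp_step 0 r)@_(mnm_raise u) = q ^- u ord0 * r@_u.
Proof.
move=> r_le; rewrite /interp_step /mwiden_scale /monomial_map msupp0 big_nil add0r.
rewrite mcoeff_mulX_sub1_raise.
  by apply: mcoeff_monomial_map; exact: mnm_rot_inj.
by apply: leq_trans r_le; apply: msize_monomial_map; exact: mdeg_rot.
Qed.

(** Induction on the number of variables and on [d]: [p] fits the values at the nodes <(u, 0)>,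
    where the factor x_n - 1 vanishes, and [r], of one degree less, fits what is left at the nodes
    <Phi u>. *)
Lemma interp_exists n d (f : 'X_{1..n} -> K) :
  exists2 p : {mpoly K[n]}, (msize p <= d)%N &
    forall u, (mdeg u < d)%N -> p.@[sp u] = f u.
Proof.
elim: n d f => [|n IHn] d f.
  case: d => [|d]; first by exists 0; rewrite ?msize0.
  exists (f 0%MM)%:MP; first by rewrite msizeC; case: eqP.
  by move=> u _; rewrite mevalC; congr f; apply/mnmP; case.
elim: d f => [|d IHd] f; first by exists 0; rewrite ?msize0.
have [p p_le pE] := IHn d.+1 (fun u => f (mnmwiden u)).
have [r r_le rE] := IHd (fun u =>
  (f (mnm_raise u) - (mwiden_scale p).@[sp (mnm_raise u)])
    / (sp (mnm_raise u) ord_max - 1)).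
exists (interp_step p r); first exact: msize_interp_step.
move=> v; case: (mnm_widen_or_raise v) => -[u ->].
  by rewrite mdeg_mnmwiden => /pE; rewrite interp_step_widen.
rewrite mdeg_raise ltnS => /rE; rewrite interp_step_raise => ->.
by rewrite mulrC divfK ?spectral_raise_max_sub1 // addrC subrK.
Qed.

(* The evaluation matrix at the points <v>, |v| < d, is square and, by
   interp_exists, has a right inverse; hence it is invertible. *)
Lemma interp_unique n d (p : {mpoly K[n]}) :
  (msize p <= d)%N -> (forall u, (mdeg u < d)%N -> p.@[sp u] = 0) -> p = 0.
Proof.
move=> p_le p0; pose I := 'X_{1..n < d}; pose N := #|{: I}|.
pose m (i : 'I_N) : 'X_{1..n} := bmnm (enum_val i).
have m_lt i : (mdeg (m i) < d)%N by apply: bmdeg.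
pose E := \matrix_(i < N, j < N) \prod_k sp (m i) k ^+ m j k.
have evalE (r : {mpoly K[n]}) i : (msize r <= d)%N ->
    r.@[sp (m i)] = \sum_j E i j * r@_(m j).
  move=> r_le; rewrite (meval_widthE _ r_le) (reindex (@enum_val I predT)) /=.
    by apply: eq_bigr => j _; rewrite mxE mulrC.
  by apply: onW_bij; exact: enum_val_bij.
have /choice[L LP] (j : 'I_N) : exists r : {mpoly K[n]},
    (msize r <= d)%N /\ forall u, (mdeg u < d)%N -> r.@[sp u] = (u == m j)%:R.
  by have [r] := interp_exists d (fun u => (u == m j)%:R); exists r.
have EF1 : E *m (\matrix_(i, j) (L j)@_(m i)) = 1%:M.
  apply/matrixP => i j; rewrite !mxE; have [L_le Lval] := LP j.
  under eq_bigr do rewrite [X in _ * X]mxE.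
  rewrite -(evalE (L j) i L_le) Lval //; congr (nat_of_bool _)%:R.
  by apply/eqP/eqP => [/val_inj/enum_val_inj|->].
have Ep0 : E *m (\col_j p@_(m j)) = 0.
  apply/matrixP => i j; rewrite !mxE -[RHS](p0 (m i)) // evalE //.
  by apply: eq_bigr => k _; rewrite [X in _ * X]mxE.
have /matrixP c0 : \col_j p@_(m j) = 0.
  by rewrite -[LHS]mul1mx -(mulmx1C EF1) -mulmxA Ep0 mulmx0.
apply/mpolyP => u; rewrite mcoeff0; case: (ltnP (mdeg u) d) => [lt_u|]; last first.
  exact/msize_leP.
by have := c0 (enum_rank (BMultinom lt_u)) ord0; rewrite !mxE /m enum_rankK.
Qed.

(** The coefficient of a^|u| in the product of all 1 - a t^(k_i) q^j with j < u_i; it turns out to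
    be the value of the normalised M_u at <u>. *)
Definition top_value n (u : 'X_{1..n}) : K :=
  \prod_(i < n) \prod_(j < u i) - (t ^+ spectral_exp u i * q ^+ j).

Lemma top_value_widen n (u : 'X_{1..n}) :
  top_value (mnmwiden u) = t ^+ mdeg u * top_value u.
Proof.
rewrite /top_value big_ord_recr /= mnmwiden_ordmax big_ord0 mulr1 mdegE.
rewrite -prodrXr -big_split /=; apply: eq_bigr => i _.
rewrite mnmwiden_widen spectral_exp_widen.
under eq_bigr do rewrite exprS -mulrA -mulrN.
by rewrite big_split /= prodr_const card_ord.
Qed.

Lemma top_value_raise n (u : 'X_{1..n.+1}) :
  top_value (mnm_raise u) = - sp u ord0 * top_value u.
Proof.
rewrite /top_value [in RHS](reindex_inj (@ordS_inj _)) /=.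
rewrite [LHS](bigD1 (ord_max : 'I_n.+1)) // [in RHS](bigD1 (ord_max : 'I_n.+1)) //=.
rewrite mulrA; congr (_ * _).
  rewrite mnm_raiseE eqxx addn1 big_ord_recr /= spectral_exp_raise ordS_max mulrC.
  by rewrite [t ^+ _ * _]mulrC.
apply: eq_bigr => i /negPf ne_i.
by rewrite mnm_raiseE ne_i addn0 spectral_exp_raise.
Qed.

Lemma top_value_neq0 n (u : 'X_{1..n}) : top_value u != 0.
Proof.
by do 2!(apply/prodf_neq0 => ? _); rewrite oppr_eq0 mulf_neq0 ?expf_neq0.
Qed.

Lemma hookprodE n (u : 'X_{1..n}) :
  hookprod q t u = diagram_big *%R (fun a l => 1 - q ^+ a.+1 * t ^+ l) u.
Proof. by []. Qed.

Lemma nstatE n (u : 'X_{1..n}) : nstat u = diagram_big addn (fun _ l => l) u.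
Proof. by []. Qed.

Lemma hookprod_neq0 n (u : 'X_{1..n}) : hookprod q t u != 0.
Proof.
apply/prodf_neq0 => i _; rewrite prodf_seq_neq0; apply/allP => j _ /=.
by rewrite subr_eq0 eq_sym qt_generic.
Qed.

(** The normalised M_u has coefficient t^n(u) / c'_u at x^u; dividing by its value [top_value u] at
    <u> gives the coefficient expected of the Lagrange polynomial. *)
Definition lagrange_coef n (u : 'X_{1..n}) : K :=
  t ^+ nstat u / (hookprod q t u * top_value u).

Lemma lagrange_coef_neq0 n (u : 'X_{1..n}) : lagrange_coef u != 0.
Proof.
by rewrite mulf_neq0 ?invr_eq0 ?mulf_neq0 ?hookprod_neq0 ?top_value_neq0 ?expf_neq0.
Qed.

Lemma lagrange_coef_widen n (u : 'X_{1..n}) :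
  lagrange_coef (mnmwiden u) = t ^- mdeg u * lagrange_coef u.
Proof.
rewrite /lagrange_coef top_value_widen hookprodE nstatE !diagram_big_widen.
by rewrite mulrCA invfM mulrCA.
Qed.

(** With k = k_1, the new cell contributes t^k / (1 - q^(u_1 + 1) t^k) and [top_value] gains -
    q^(u_1) t^k. The powers of t cancel, and the sign turns the denominator into x_n - 1 at <Phi
    u>. *)
Lemma lagrange_coef_raise n (u : 'X_{1..n.+1}) :
  lagrange_coef (mnm_raise u)
  = q ^- u ord0 * (lagrange_coef u / (sp (mnm_raise u) ord_max - 1)).
Proof.
have := spectral_raise_max_sub1 u; rewrite spectral_raise_max /spectral => s_neq1.
rewrite /lagrange_coef top_value_raise !hookprodE !nstatE !diagram_big_raise /=.
rewrite -!hookprodE -!nstatE exprD /spectral.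
have s0 : 1 - q ^+ (u ord0).+1 * t ^+ spectral_exp u ord0 != 0.
  by rewrite subr_eq0 eq_sym qt_generic.
have := hookprod_neq0 u; have := top_value_neq0 u.
have : q ^+ u ord0 != 0 by rewrite expf_neq0.
have : t ^+ spectral_exp u ord0 != 0 by rewrite expf_neq0.
move: s0 s_neq1; rewrite exprS.
move: (q ^+ u ord0) (t ^+ spectral_exp u ord0) (hookprod _ _ _) (top_value _) (t ^+ nstat u).
move=> a b c e f s0 s1 b0 a0 e0 c0; field.
by rewrite s0 s1 a0 c0 e0 oppr_eq0 mulf_neq0.
Qed.

(** Follows the construction of [u]: [interp_step] carries the values and the coefficient at x^u
    along both operations. *)
Lemma lagrange_exists n (u : 'X_{1..n}) :
  exists p : {mpoly K[n]}, [/\ (msize p <= (mdeg u).+1)%N,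
    forall v, (mdeg v <= mdeg u)%N -> p.@[sp v] = (v == u)%:R
    & p@_u = lagrange_coef u].
Proof.
elim/mnm_ind: n / u => [|n u [p [p_le pE pu]]|n u [p [p_le pE pu]]].
- exists 1; split; first by rewrite msize1.
    by move=> v _; rewrite meval1 (_ : v = 0%MM) ?eqxx //; apply/mnmP; case.
  rewrite mcoeff1 eqxx /lagrange_coef /top_value hookprodE nstatE !diagram_big0.
  by rewrite big_ord0 mulr1 divr1.
(* [r] cancels the values at the raised nodes. Its degree is so low that its top-degree
   contributions all contain the last variable and leave the coefficient at (u, 0) alone. *)
- have [r r_le rE] := interp_exists (mdeg u) (fun v =>
    - (mwiden_scale p).@[sp (mnm_raise v)] / (sp (mnm_raise v) ord_max - 1)).
  exists (interp_step p r); rewrite mdeg_mnmwiden; split.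
  + exact: msize_interp_step.
  + move=> w; case: (mnm_widen_or_raise w) => -[v ->].
      by rewrite mdeg_mnmwiden interp_step_widen (inj_eq (@inj_mnmwiden _)) => /pE.
    rewrite mdeg_raise interp_step_raise => /rE ->.
    rewrite mulrC divfK ?spectral_raise_max_sub1 // subrr.
    case: eqP => // /mnmP/(_ ord_max).
    by rewrite mnmwiden_ordmax mnm_raiseE eqxx addn1.
  + by rewrite mcoeff_interp_step_widen // pu lagrange_coef_widen.
(* [c] compensates the factor x_n - 1 at <Phi u>, so that the value there is 1. *)
pose c := (sp (mnm_raise u) ord_max - 1)^-1.
have cp_le : (msize (c *: p) <= (mdeg u).+1)%N by apply: leq_trans (msizeZ_le _ _) _.
exists (interp_step 0 (c *: p)); rewrite mdeg_raise; split.
- by apply: msize_interp_step => //; rewrite msize0.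
- have w0 : mwiden_scale (0 : {mpoly K[n]}) = 0.
    by rewrite /mwiden_scale /monomial_map msupp0 big_nil.
  move=> w; case: (mnm_widen_or_raise w) => -[v ->].
    rewrite interp_step_widen meval0 => _; case: eqP => // /mnmP/(_ ord_max).
    by rewrite mnmwiden_ordmax mnm_raiseE eqxx addn1.
  rewrite mdeg_raise ltnS interp_step_raise w0 meval0 add0r mevalZ => /pE ->.
  case: (eqVneq v u) => [->|ne_vu]; first by rewrite eqxx mulr1 divff ?spectral_raise_max_sub1.
  rewrite !mulr0; case: eqP => // /mnmP eq_vu; case/eqP: ne_vu; apply/mnmP => i.
  by have := eq_vu (ord_pred i); rewrite !mnm_raiseE ord_predK => /addIn.
by rewrite mcoeff_interp_step0_raise // mcoeffZ pu lagrange_coef_raise [c * _]mulrC.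
Qed.

(** The difference of the two sides vanishes at every <v> with |v| <= |u|. *)
Lemma is_interp_Macdonald_unique n (u : 'X_{1..n}) (p e : {mpoly K[n]}) :
    is_interp_Macdonald q t u p -> (msize e <= (mdeg u).+1)%N ->
    (forall v, (mdeg v <= mdeg u)%N -> e.@[sp v] = (v == u)%:R) ->
  p = p.@[sp u] *: e.
Proof.
move=> [p_size p0 _] e_le eE; apply/eqP; rewrite -subr_eq0; apply/eqP.
apply: (@interp_unique n (mdeg u).+1).
  apply: msizeD_leq; first by rewrite p_size.
  by rewrite -scaleNr; apply: leq_trans (msizeZ_le _ _) _.
move=> v; rewrite ltnS => v_le; rewrite mevalB mevalZ eE //.
by case: (eqVneq v u) => [->|/eqP ne_vu]; rewrite ?mulr1 ?subrr // p0 // mulr0 subr0.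
Qed.

(** Excludes the default value of [xget]: the Lagrange polynomial has a nonzero coefficient at x^u
    and can be rescaled to the prescribed one. *)
Lemma interp_MacdonaldP n (u : 'X_{1..n}) :
  is_interp_Macdonald q t u (interp_Macdonald q t u).
Proof.
have [e [e_le eE eu]] := lagrange_exists u.
apply: (@xgetPex _ 0 (is_interp_Macdonald q t u)).
have c0 : q ^- nstat' u / lagrange_coef u != 0.
  by rewrite mulf_neq0 ?invr_eq0 ?expf_neq0 ?lagrange_coef_neq0.
exists ((q ^- nstat' u / lagrange_coef u) *: e); split.
- apply/eqP; rewrite msizeZ // eqn_leq e_le ltnNge; apply/msize_leP => /(_ u (leqnn _)).
  by apply/eqP; rewrite eu lagrange_coef_neq0.
- by move=> v v_le ne_vu; rewrite mevalZ eE //; case: eqP => // _; rewrite mulr0.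
- by rewrite mcoeffZ eu divfK ?lagrange_coef_neq0.
Qed.

Lemma msize_normed_interp_Macdonald n (u : 'X_{1..n}) :
  (msize (normed_interp_Macdonald q t u) <= (mdeg u).+1)%N.
Proof.
by have [<- _ _] := interp_MacdonaldP u; apply: msizeZ_le.
Qed.

(** M_u is M_u(<u>) times the Lagrange polynomial; comparing coefficients at x^u gives M_u(<u>) =
    q^(-n'(u)) / [lagrange_coef u], and the normalisation leaves [top_value u]. *)
Lemma normed_interp_Macdonald_spectral n (u v : 'X_{1..n}) : (mdeg v <= mdeg u)%N ->
  (normed_interp_Macdonald q t u).@[sp v] = if v == u then top_value u else 0.
Proof.
move=> v_le; have Mu := interp_MacdonaldP u; rewrite mevalZ.
case: eqVneq => [->|/eqP ne_vu]; last by case: Mu => _ -> //; rewrite mulr0.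
have [e [e_le eE eu]] := lagrange_exists u.
have := is_interp_Macdonald_unique Mu e_le eE; move/(congr1 (mcoeff u)).
case: Mu => _ _ ->; rewrite mcoeffZ eu /lagrange_coef => qE.
move: (meval _ _) qE => y qE.
have -> : q ^+ nstat' u = (y * (t ^+ nstat u / (hookprod q t u * top_value u)))^-1.
  by rewrite -qE invrK.
have y0 : y != 0.
  apply: contraTneq isT => y0; move: qE; rewrite y0 mul0r => /eqP.
  by rewrite invr_eq0 expf_eq0 (negPf q_neq0) andbF.
have := hookprod_neq0 u; have := top_value_neq0 u.
have : t ^+ nstat u != 0 by rewrite expf_neq0.
move: y y0 {qE} => y y0; move: (t ^+ _) (hookprod _ _ _) (top_value u).
by move=> T c e' T0 e0 c0; field; rewrite y0 T0 c0 e0.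
Qed.

End Interpolation.

(** * Power series and the q-Pochhammer symbol *)

Section FpsTheory.
Variable K : fieldType.
Implicit Types f g h : fps K.

Definition fps_of_poly (p : {poly K}) : fps K := fun m => p`_m.

Lemma fps_of_polyM p r :
  fps_of_poly (p * r) = fps_mul (fps_of_poly p) (fps_of_poly r).
Proof. by apply/funext => m; rewrite /fps_of_poly coefM. Qed.

Lemma fps_of_poly1 : fps_of_poly 1 = @fps_one K.
Proof. by apply/funext => m; rewrite /fps_of_poly coef1. Qed.

Lemma fps_mul_trunc f g f' g' m :
    (forall i, (i <= m)%N -> f i = f' i) -> (forall i, (i <= m)%N -> g i = g' i) ->
  fps_mul f g m = fps_mul f' g' m.
Proof.
move=> ff' gg'; apply: eq_bigr => i _.
by rewrite ff' ?gg' ?leq_subr // -ltnS.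
Qed.

Lemma fps_mulC : commutative (@fps_mul K).
Proof.
move=> f g; apply/funext => m; rewrite /fps_mul (reindex_inj rev_ord_inj) /=.
by apply: eq_bigr => i _; rewrite mulrC subSS subKn // -ltnS.
Qed.

(** Coefficient m involves only coefficients up to m, so truncation reduces this to associativity
    for polynomials. *)
Lemma fps_mulA : associative (@fps_mul K).
Proof.
move=> f g h; apply/funext => m.
pose T f := fps_of_poly (\poly_(i < m.+1) f i).
have TE f' i : (i <= m)%N -> f' i = T f' i.
  by move=> le_im; rewrite /T /fps_of_poly coef_poly ltnS le_im.
have TME f' g' i : (i <= m)%N -> fps_mul f' g' i = fps_mul (T f') (T g') i.
  by move=> le_im; apply: fps_mul_trunc => j le_ji; apply/TE/(leq_trans le_ji).
rewrite (fps_mul_trunc (TE f) (TME g h)) (fps_mul_trunc (TME f g) (TE h)).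
by rewrite -!fps_of_polyM mulrA.
Qed.

Lemma fps_mul1 : left_id (@fps_one K) (@fps_mul K).
Proof.
move=> f; apply/funext => m; rewrite /fps_mul big_ord_recl /fps_one /= mul1r subn0.
by rewrite big1 ?addr0 // => i _; rewrite mul0r.
Qed.

End FpsTheory.

HB.instance Definition _ (K : fieldType) :=
  Monoid.isComLaw.Build (fps K) (@fps_one K) (@fps_mul K)
    (@fps_mulA K) (@fps_mulC K) (@fps_mul1 K).

Lemma fps_of_poly_prod (K : fieldType) (I : Type) (r : seq I) (F : I -> {poly K}) :
  fps_of_poly (\prod_(i <- r) F i) = \big[@fps_mul K/@fps_one K]_(i <- r) fps_of_poly (F i).
Proof. exact: (big_morph _ (@fps_of_polyM K) (@fps_of_poly1 K)). Qed.

Lemma fps_mulK (K : fieldType) (f g : fps K) : g 0%N != 0 -> fps_div (fps_mul f g) g = f.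
Proof.
by move=> g0; rewrite /fps_div -fps_mulA [fps_mul g _]fps_mulC fps_invP // Monoid.mulm1.
Qed.

(** Replacing a by a z is multiplicative, hence commutes with inversion; it makes the coefficients
    of 1/(a x_i)_oo multiples of powers of x_i. *)
Lemma fps_inv_scale (K : fieldType) (e : fps K) (z : K) : e 0%N != 0 ->
  fps_inv (fun m => e m * z ^+ m) = (fun m => fps_inv e m * z ^+ m).
Proof.
move=> e0; set f := fun m => _; set g := (RHS).
have f0 : f 0%N != 0 by rewrite /f mulr1.
have gf1 : fps_mul g f = @fps_one K.
  apply/funext => m; have /(congr1 (fun h => h m * z ^+ m)) := fps_invP e0.
  rewrite /fps_mul mulr_suml => eq1; apply: etrans; last apply: etrans eq1 _.
    apply: eq_bigr => i _; rewrite /f /g mulrACA -exprD subnKC // -ltnS //.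
  by rewrite /fps_one; case: m => [|m]; rewrite ?mulr1 ?mul0r.
by rewrite -[g](fps_mulK _ f0) gf1 /fps_div fps_mul1.
Qed.

Lemma coefM_top (K : fieldType) (p r : {poly K}) a b :
  (size p <= a.+1)%N -> (size r <= b.+1)%N ->
  (size (p * r)%R <= (a + b).+1)%N /\ (p * r)`_(a + b) = p`_a * r`_b.
Proof.
move=> p_le r_le; split.
  apply: leq_trans (size_polyMleq _ _) _.
  by rewrite -subn1 leq_subLR add1n -addSn -addnS leq_add.
have lt_a : (a < (a + b).+1)%N by rewrite ltnS leq_addr.
rewrite coefM (bigD1 (Ordinal lt_a)) //= addKn big1 ?addr0 // => i ne_i.
case: (ltngtP i a) => [lt_ia|lt_ai|eq_ia]; last by case/eqP: ne_i; apply: ord_inj.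
  by rewrite [r`_ _]nth_default ?mulr0 //; apply: leq_trans r_le _; lia.
by rewrite nth_default ?mul0r //; apply: leq_trans p_le _.
Qed.

Lemma coef_prod_top (K : fieldType) (I : Type) (r : seq I) (p : I -> {poly K})
    (d : I -> nat) : (forall i, (size (p i) <= (d i).+1)%N) ->
  (size (\prod_(i <- r) p i)%R <= (\sum_(i <- r) d i).+1)%N /\
  (\prod_(i <- r) p i)`_(\sum_(i <- r) d i) = \prod_(i <- r) (p i)`_(d i).
Proof.
move=> p_le; elim: r => [|i r [r_le rE]].
  by rewrite !big_nil size_poly1 coef1.
by rewrite !big_cons -rE; apply: coefM_top.
Qed.

(** * Finite and infinite q-Pochhammer symbols as series in a *)

Section QPochhammer.
Variables (K : fieldType) (q : K).
Hypothesis q_not_root : forall m : nat, 1 - q ^+ m.+1 != 0.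

Definition qpoch_poly (N : nat) (z : K) : {poly K} :=
  \prod_(i < N) (1 - (z * q ^+ i) *: 'X).

Lemma coef_qpoch_polyS N z m :
  (qpoch_poly N.+1 z)`_m.+1 = (qpoch_poly N z)`_m.+1 - z * q ^+ N * (qpoch_poly N z)`_m.
Proof.
by rewrite /qpoch_poly big_ord_recr /= mulrBr mulr1 coefB -scalerAr coefZ coefMX.
Qed.

Lemma coef0_qpoch_poly N z : (qpoch_poly N z)`_0 = 1.
Proof.
elim: N => [|N IHN]; first by rewrite /qpoch_poly big_ord0 coef1.
by rewrite /qpoch_poly big_ord_recr /= mulrBr mulr1 coefB -scalerAr coefZ coefMX mulr0 subr0.
Qed.

Lemma coef_qpoch_poly_scale N z m : (qpoch_poly N z)`_m = (qpoch_poly N 1)`_m * z ^+ m.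
Proof.
elim: N m => [|N IHN] [|m]; rewrite ?coef0_qpoch_poly ?mulr1 //.
  by rewrite /qpoch_poly !big_ord0 coef1 mul0r.
by rewrite !coef_qpoch_polyS !IHN exprS; ring.
Qed.

(** The ratio of consecutive coefficients in the q-binomial theorem; as q^N tends to 0 it becomes
    the recursion of [qpoch_coef]. *)
Lemma coef_qpoch_poly_rec N m :
  (1 - q ^+ m.+1) * (qpoch_poly N 1)`_m.+1 = (q ^+ N - q ^+ m) * (qpoch_poly N 1)`_m.
Proof.
elim: N m => [|N IHN] m.
  by rewrite /qpoch_poly !big_ord0 !coef1 mulr0; case: m => [|m]; rewrite ?subrr ?mul0r ?mulr0.
rewrite coef_qpoch_polyS mul1r mulrBr IHN; case: m => [|m].
  by rewrite !coef0_qpoch_poly [q ^+ N.+1]exprS; ring.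
rewrite coef_qpoch_polyS mul1r.
have := IHN m; move: (qpoch_poly N 1)`_m (qpoch_poly N 1)`_m.+1 => a b.
rewrite !exprS; move: (q ^+ N) (q ^+ m) => x y eq_ab.
rewrite -[LHS]subr0 -[RHS]subr0; apply/eqP; rewrite -subr_eq0; apply/eqP.
(* After the induction hypothesis at m + 1, the two sides differ by a multiple of the hypothesis at
   m. *)
transitivity (- (q * x) * ((1 - q * y) * b - (x - y) * a)); first by ring.
by rewrite eq_ab subrr mulr0.
Qed.

Lemma size_qpoch_poly N z : (size (qpoch_poly N z) <= N.+1)%N.
Proof.
elim: N => [|N IHN]; first by rewrite /qpoch_poly big_ord0 size_poly1.
apply/leq_sizeP => -[//|m] lt_m; have lt_Nm : (N < m)%N by [].
rewrite coef_qpoch_polyS !nth_default ?mulr0 ?subr0 //; first exact: leq_trans IHN _.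
by apply: leq_trans IHN _; apply: ltnW.
Qed.

Lemma coef_top_qpoch_poly N z : (qpoch_poly N z)`_N = \prod_(i < N) - (z * q ^+ i).
Proof.
elim: N => [|N IHN]; first by rewrite /qpoch_poly !big_ord0 coef1.
rewrite coef_qpoch_polyS nth_default ?size_qpoch_poly // sub0r -mulNr IHN.
by rewrite big_ord_recr /= mulrC.
Qed.

(** Euler's coefficients (-1)^m q^(m(m-1)/2) / ((1 - q) ... (1 - q^m)) of (a)_oo. *)
Fixpoint qpoch_coef (m : nat) : K :=
  if m is m'.+1 then - q ^+ m' / (1 - q ^+ m'.+1) * qpoch_coef m' else 1.

Definition qpoch_fps (z : K) : fps K := fun m => qpoch_coef m * z ^+ m.

Lemma qpoch_fpsS z :
  qpoch_fps z = fps_mul (fps_of_poly (1 - z *: 'X)) (qpoch_fps (z * q)).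
Proof.
have lin : (size (1 - z *: 'X)%R <= 2)%N.
  apply: leq_trans (size_polyD _ _) _; rewrite size_poly1 size_polyN geq_max /=.
  by apply: leq_trans (size_scale_leq _ _) _; rewrite size_polyX.
apply/funext => -[|m]; rewrite /fps_mul /fps_of_poly /qpoch_fps.
  by rewrite big_ord_recl big_ord0 coefB coef1 coefZ coefX /= !mulr1 mulr0 subr0 addr0.
rewrite big_ord_recl /= big_ord_recl big1 ?addr0 => [|i _]; last first.
  by rewrite nth_default ?mul0r //; apply: leq_trans lin _.
rewrite /= /bump /= !coefB !coef1 !coefZ !coefX /= subn0 subSS subn0 !exprMn !exprS.
have := q_not_root m; rewrite exprS => q0.
by move: (q ^+ m) (z ^+ m) (qpoch_coef m) q0 => x y c q0; field.
Qed.

Lemma qpoch_fps_split N z :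
  qpoch_fps z = fps_mul (fps_of_poly (qpoch_poly N z)) (qpoch_fps (z * q ^+ N)).
Proof.
elim: N => [|N IHN].
  by rewrite /qpoch_poly big_ord0 fps_of_poly1 fps_mul1 mulr1.
rewrite IHN qpoch_fpsS fps_mulA -fps_of_polyM /qpoch_poly big_ord_recr /=.
by rewrite -mulrA -exprSr.
Qed.

(** The common tail has constant coefficient 1 and cancels formally, without any limit. *)
Lemma qpoch_fps_ratio N z :
  fps_div (qpoch_fps z) (qpoch_fps (z * q ^+ N)) = fps_of_poly (qpoch_poly N z).
Proof. by rewrite (qpoch_fps_split N z) fps_mulK // /qpoch_fps mulr1 oner_neq0. Qed.

(** The form in which [interp_unique] can be applied: the power of a bounds the degree in x, a
    condition stable under products. *)
Definition mpoly_fps_fun n (F : ('I_n -> K) -> fps K) : Prop :=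
  exists P : nat -> {mpoly K[n]},
    forall k, (msize (P k) <= k.+1)%N /\ forall x, F x k = (P k).@[x].

Lemma mpoly_fps_fun1 n : mpoly_fps_fun (fun _ : 'I_n -> K => @fps_one K).
Proof.
exists (fun k => (k == 0%N)%:R%:MP) => k; split=> [|x]; last by rewrite mevalC.
by rewrite msizeC; case: eqP.
Qed.

Lemma mpoly_fps_funM n (F G : ('I_n -> K) -> fps K) :
  mpoly_fps_fun F -> mpoly_fps_fun G -> mpoly_fps_fun (fun x => fps_mul (F x) (G x)).
Proof.
move=> [P FP] [Q GQ]; exists (fun k => \sum_(i < k.+1) P i * Q (k - i)%N) => k.
split=> [|x].
  apply: msize_sum_leq => i _; rewrite -[X in (_ <= X.+1)%N](@subnKC i) -1?ltnS //.
  by apply: msizeM_leq; [case: (FP i)|case: (GQ (k - i)%N)].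
rewrite raddf_sum; apply: eq_bigr => i _ /=.
by rewrite mevalM; case: (FP i) => _ ->; case: (GQ (k - i)%N) => _ ->.
Qed.

Lemma mpoly_fps_fun_big n (I : Type) (r : seq I) (F : I -> ('I_n -> K) -> fps K) :
  (forall i, mpoly_fps_fun (F i)) ->
  mpoly_fps_fun (fun x => \big[@fps_mul K/@fps_one K]_(i <- r) F i x).
Proof.
move=> FP; elim: r => [|i r IHr].
  have [P PE] := mpoly_fps_fun1 n; exists P => k; have [le_k E] := PE k.
  by split=> // x; rewrite big_nil (E x).
have [P PE] := mpoly_fps_funM (FP i) IHr; exists P => k; have [le_k E] := PE k.
by split=> // x; rewrite big_cons E.
Qed.

Lemma mpoly_fps_fun_ratio n b (i : 'I_n) :
  mpoly_fps_fun (fun x => fps_div (qpoch_fps b) (qpoch_fps (x i))).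
Proof.
apply: mpoly_fps_funM.
  exists (fun k => (qpoch_fps b k)%:MP) => k; rewrite msizeC; split=> [|x].
    by case: eqP.
  by rewrite mevalC.
exists (fun k => fps_inv qpoch_coef k *: 'X_i ^+ k) => k; split=> [|x].
  by apply: leq_trans (msizeZ_le _ _) _; rewrite mpolyXn msizeX mdegMn mdeg1 mul1n.
by rewrite [fps_inv _]fps_inv_scale ?oner_neq0 // mevalZ rmorphXn /= mevalXU.
Qed.

End QPochhammer.

(** * Coefficientwise convergence of the infinite product *)

Lemma cvg_expr_complex (R : realType) (q : R[i]) : `|q| < 1 ->
  ((q ^+ n : R[i]^o) @[n --> \oo] --> (0 : R[i]^o))%classic.
Proof.
move=> q_lt1; apply/cvgr0Pnorm_lt => e e_gt0.
(* Norms in [R[i]] are again elements of [R[i]]; taking real parts of |q| and of e reduces the claim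
   to a real geometric sequence. *)
have real_ofRe (z : R[i]) : 0 <= z -> (complex.Re z)%:C%C = z.
  by move=> z0; apply: RRe_real; apply: ger0_real.
pose r := complex.Re `|q|.
have rE : r%:C%C = `|q| by apply: real_ofRe.
have r_ge0 : 0 <= r by rewrite -lecR rE; exact: normr_ge0.
have r_lt1 : `|r| < 1 by rewrite ger0_norm // -ltcR rE.
have Re_gt0 : 0 < complex.Re e by rewrite -ltcR real_ofRe // ltW.
have := @cvgr0_norm_lt R _ _ _ eventually_filter (_ : nat -> R^o) (cvg_geometric 1 r_lt1) _ Re_gt0.
apply: filterS => n /=; rewrite mul1r normrX ger0_norm //.
by rewrite -ltcR rmorphXn /= rE normrX real_ofRe // ltW.
Qed.

(** The power of z splits off each coefficient, and for z = 1 the recursion in m at fixed N passes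
    to the limit. *)
Lemma qpoch_seriesE (R : realType) (q z : R[i]) : `|q| < 1 ->
  (forall m : nat, 1 - q ^+ m.+1 != 0) -> qpoch_series q z = qpoch_fps q z.
Proof.
move=> q_lt1 q_not_root; apply/funext => m.
rewrite /qpoch_series; apply: (@cvg_lim (R[i]^o)); first exact: norm_hausdorff.
under eq_fun do rewrite -/(qpoch_poly q _ z) coef_qpoch_poly_scale.
apply: (@cvgM R[i]); last exact: cvg_cst.
elim: m => [|m IHm].
  by under eq_fun do rewrite coef0_qpoch_poly; exact: cvg_cst.
have recE N : (qpoch_poly q N 1)`_m.+1
    = (q ^+ N - q ^+ m) / (1 - q ^+ m.+1) * (qpoch_poly q N 1)`_m.
  by apply: (mulfI (q_not_root m)); rewrite coef_qpoch_poly_rec mulrAC mulrCA divff ?mulr1.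
under eq_fun do rewrite recE.
rewrite [qpoch_coef _ _]/=; apply: (@cvgM R[i]); last exact: IHm.
apply: (@cvgM R[i]); last exact: cvg_cst.
rewrite -[X in (_ --> X)%classic]sub0r.
by apply: (@cvgB R[i] R[i]^o); [exact: cvg_expr_complex|exact: cvg_cst].
Qed.

(* At x = <v> the infinite products telescope, factor by factor, since the
   exponents of t in <v> are a permutation of 0, ..., n - 1. *)
Lemma qpoch_ratio_spectral (K : fieldType) (q t : K) n (v : 'X_{1..n}) :
    (forall m : nat, 1 - q ^+ m.+1 != 0) ->
  \big[@fps_mul K/@fps_one K]_(i < n)
    fps_div (qpoch_fps q (t ^+ (n - i.+1))) (qpoch_fps q (spectral q t v i))
  = fps_of_poly (\prod_(i < n) qpoch_poly q (v i) (t ^+ spectral_exp v i)).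
Proof.
move=> q_not_root; rewrite fps_of_poly_prod; under [RHS]eq_bigr do
  rewrite -(qpoch_fps_ratio q_not_root) [_ * q ^+ _]mulrC -/(spectral q t v _).
rewrite /fps_div !big_split /=; congr fps_mul.
rewrite (reindex_inj rev_ord_inj) /=.
pose k (i : 'I_n) := Ordinal (spectral_exp_lt v i).
have k_inj : injective k by move=> i j /(congr1 val)/= /spectral_exp_inj.
rewrite (reindex_inj k_inj) /=; apply: eq_bigr => i _.
by rewrite subnSK ?spectral_exp_lt // subKn // ltnW ?spectral_exp_lt.
Qed.

Theorem corollary8p2 (R : realType) (n : nat) (q t : R[i]) (x : 'I_n -> R[i])
    (n_gt0 : (0 < n)%N)
    (q_neq0 : q != 0) (q_lt1 : `|q| < 1) (t_neq0 : t != 0)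
    (qt_generic : forall i j : nat, (0 < i)%N -> q ^+ i * t ^+ j != 1) :
  composition_series
    (fun u : 'X_{1..n} => (normed_interp_Macdonald q t u).@[x])
  = \big[@fps_mul R[i]/@fps_one R[i]]_(i < n)
      fps_div (qpoch_series q (t ^+ (n - i.+1))) (qpoch_series q (x i)).
Proof.
have q_not_root m : 1 - q ^+ m.+1 != 0.
  by rewrite subr_eq0 eq_sym -[q ^+ _]mulr1 -(expr0 t) qt_generic.
under [RHS]eq_bigr do rewrite !(qpoch_seriesE _ q_lt1 q_not_root).
have [P PE] := mpoly_fps_fun_big (index_enum 'I_n)
  (fun i => mpoly_fps_fun_ratio q (t ^+ (n - i.+1)) i).
apply/funext => k; have [P_le ->] := PE k.
(* The coefficient of a^k on the left, as a polynomial in x; the claim becomes an equality of two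
   polynomials of degree at most k. *)
pose S := \sum_(u : 'X_{1..n < k.+1} | mdeg u == k) normed_interp_Macdonald q t u.
have -> : composition_series
    (fun u : 'X_{1..n} => (normed_interp_Macdonald q t u).@[x]) k = S.@[x].
  by rewrite raddf_sum.
suff -> : S = P k by [].
apply/eqP; rewrite -subr_eq0; apply/eqP.
apply: (interp_unique q_neq0 t_neq0 qt_generic (d := k.+1)).
  apply: msizeD_leq; last by rewrite msizeN.
  apply: msize_sum_leq => u /eqP u_deg; rewrite -[X in (_ <= X.+1)%N]u_deg.
  exact: (msize_normed_interp_Macdonald q_neq0 t_neq0 qt_generic).
move=> v; rewrite ltnS => v_le; rewrite mevalB.
have [_ <-] := PE k; rewrite qpoch_ratio_spectral // /fps_of_poly.
have [R_le R_top] := coef_prod_top (index_enum 'I_n)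
  (fun i => size_qpoch_poly q (v i) (t ^+ spectral_exp v i)).
rewrite -mdegE in R_le R_top.
rewrite raddf_sum /=; under eq_bigr => u /eqP u_deg do
  rewrite (normed_interp_Macdonald_spectral q_neq0 t_neq0 qt_generic) ?u_deg //.
(* For |v| < k both sides vanish, the right one because its degree in a is at most |v|. For |v| = k
   only u = v contributes, and both sides are [top_value v]. *)
case: (ltngtP (mdeg v) k) v_le => // [lt_v|eq_v] _.
  rewrite [_`_k]nth_default ?subr0 ?(leq_trans R_le) // big1 // => u /eqP u_deg.
  by case: eqP lt_v => // ->; rewrite u_deg ltnn.
have v_lt : (mdeg v < k.+1)%N by rewrite eq_v.
rewrite -[in _`_k]eq_v R_top (bigD1 (BMultinom v_lt)) /= ?eq_v // eqxx big1 ?addr0.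
  apply/eqP; rewrite subr_eq0; apply/eqP; apply: eq_bigr => i _.
  by rewrite coef_top_qpoch_poly.
move=> u /andP[_ ne_u]; case: eqP => // eq_vu.
by case/eqP: ne_u; apply: val_inj.
Qed.
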